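(* Let $q$ be a prime power and $1<t<k<n$ integers, and let $\mathbb{S}$ be a $q$-Steiner system $S_q(t,k,n)$. Let $\mathbb{S}'$ be the multiset $\{B' : B\in\mathbb{S}\}$, where $B'\subseteq\mathbb{F}_q^{n-1}$ is obtained from $B$ by deleting the last coordinate of every vector. Then all members of $\mathbb{S}'$ are distinct, i.e., $B'\neq C'$ for any two distinct blocks $B,C\in\mathbb{S}$.
   Context: $\mathbb{F}_q$ is the finite field with $q$ elements. A $q$-Steiner system $S_q(t,k,n)$ is a collection of $k$-dimensional subspaces of $\mathbb{F}_q^n$ (blocks) such that every $t$-dimensional subspace of $\mathbb{F}_q^n$ is contained in exactly one block. *)

(* Defs.v *)
From HB Require Import structures.
From mathcomp Require Import all_boot all_order all_algebra.

Set Implicit Arguments.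
Unset Strict Implicit.
Unset Printing Implicit Defensive.

Import GRing.Theory.
Local Open Scope ring_scope.

Definition is_q_steiner_system (F : finFieldType) (t k n : nat)
    (S : {pred {vspace 'rV[F]_n}}) : Prop :=
  (forall B, B \in S -> \dim B = k) /\
  (forall T : {vspace 'rV[F]_n}, \dim T = t ->
     exists! B, B \in S /\ (T <= B)%VS).

(* The coordinates kept are those of index j < n.-1; when n = 0 nothing is
   deleted. *)
Definition del_last (F : finFieldType) (n : nat) (v : 'rV[F]_n) :
    'rV[F]_n.-1 :=
  \row_(j < n.-1) v 0 (widen_ord (leq_pred n) j).

Fact del_last_is_linear (F : finFieldType) (n : nat) :
  linear (@del_last F n).
Proof. by move=> a u v; apply/rowP=> j; rewrite !mxE. Qed.

(* [linfun] agrees with [del_last] only because of this instance. *)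
HB.instance Definition _ (F : finFieldType) (n : nat) :=
  GRing.isLinear.Build F 'rV[F]_n 'rV[F]_n.-1 _ (@del_last F n)
    (@del_last_is_linear F n).

Definition puncture (F : finFieldType) (n : nat) (B : {vspace 'rV[F]_n}) :
    {vspace 'rV[F]_n.-1} :=
  (linfun (@del_last F n) @: B)%VS.

(* Main.v *)
(* The kernel of the puncturing map is the line spanned by the last basis
   vector.  If B' = C' then B + C lies in C plus that line, so dim (B + C) is at
   most k + 1 and dim (B :&: C) is at least k - 1 >= t.  A t-dimensional subspace
   of B :&: C is then contained in two blocks, which forces B = C. *)
Require Import Defs.
From mathcomp Require Import all_boot all_order all_algebra.

Import GRing.Theory.

(** The first [d] vectors of a basis of [U] are still free. *)
Lemma exists_subspace_dim (K : fieldType) (vT : vectType K) (U : {vspace vT})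
    (d : nat) :
  d <= \dim U -> exists2 T : {vspace vT}, \dim T = d & (T <= U)%VS.
Proof.
move=> le_dU; exists <<take d (vbasis U)>>%VS.
  have: free (take d (vbasis U)).
    apply: (@catl_free _ _ (drop d (vbasis U))).
    by rewrite cat_take_drop (basis_free (vbasisP U)).
  by move/eqP->; rewrite size_takel ?size_tuple.
by apply/span_subvP=> v /mem_take /vbasis_mem.
Qed.

(** Only an upper bound, since for [n = 0] the space, hence the kernel, is zero. *)
Lemma dim_lker_del_last (F : finFieldType) (n : nat) :
  \dim (lker (linfun (@del_last F n))) <= 1.
Proof.
case: n => [|n].
  by apply: leq_trans (dimvS (subvf _)) _; rewrite dimvf.
suff /dimvS le_ker : (lker (linfun (@del_last F n.+1))
    <= <[delta_mx 0%R ord_max : 'rV[F]_n.+1]>)%VS.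
  by apply: leq_trans le_ker _; rewrite dim_vline leq_b1.
apply/subvP=> v; rewrite memv_ker lfunE => /eqP /rowP v0.
(* All other entries of [v] vanish, so its last entry is the scalar. *)
apply/vlineP; exists (v 0%R ord_max); apply/rowP=> j.
rewrite !mxE eqxx /=; case: eqVneq => [->|neq_j]; first by rewrite mulr1.
have lt_jn : j < n by rewrite ltn_neqAle neq_j -ltnS ltn_ord.
have := v0 (Ordinal lt_jn); rewrite !mxE mulr0 => <-.
by congr (v _ _); apply: val_inj.
Qed.

(** Each [u] in [U] has the image of some [v] in [V], and [u - v] is in the kernel, so [U + V] lies
    in [V + lker f]. *)
Lemma limg_eq_dim_addv {K : fieldType} {aT rT : vectType K}
    (f : 'Hom(aT, rT)) (U V : {vspace aT}) :
  (f @: U = f @: V)%VS -> \dim (U + V) <= \dim V + \dim (lker f).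
Proof.
move=> eq_fUV; apply: leq_trans (dimv_add_leqif V (lker f)).1.
apply: dimvS; rewrite subv_add addvSl andbT; apply/subvP=> u uU.
have /memv_imgP [v vV fu] : f u \in (f @: V)%VS by rewrite -eq_fUV memv_img.
rewrite -[u](subrKC v) memv_add // memv_ker.
by rewrite linearB /= fu subrr.
Qed.

Theorem theorem11 (q : nat) (F : finFieldType) (hq : #|F| = q)
    (t k n : nat) (ht : 1 < t) (htk : t < k) (hkn : k < n)
    (S : {pred {vspace 'rV[F]_n}}) (hS : is_q_steiner_system t k S)
    (B C : {vspace 'rV[F]_n}) :
  B \in S -> C \in S -> B <> C -> puncture B <> puncture C.
Proof.
case: hS => dimS uniqS BS CS neqBC /limg_eq_dim_addv le_sum; apply: neqBC.
have le_cap : t <= \dim (B :&: C).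
  have := dimv_sum_cap B C; rewrite (dimS B BS) (dimS C CS) => eq_dim.
  rewrite (dimS C CS) in le_sum.
  (* As [t < k], it suffices that [k <= \dim (B :&: C) + 1]; adding [k] and using [eq_dim], this
     becomes [\dim (B + C) <= k + 1]. *)
  rewrite -ltnS; apply: leq_trans htk _.
  rewrite -(leq_add2l k) -eq_dim -addSnnS leq_add2r.
  by apply: leq_trans le_sum _; rewrite -(addn1 k) leq_add2l dim_lker_del_last.
have [T dimT] := exists_subspace_dim _ _ _ _ le_cap.
rewrite subv_cap => /andP[TB TC].
have [D [_ uniqD]] := uniqS T dimT.
by rewrite -(uniqD B (conj BS TB)) (uniqD C (conj CS TC)).
Qed.
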